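(* Let $H$ be a real Hilbert space, $C\subseteq H$ a nonempty closed convex set, and $F\colon H\to H$ a mapping that is monotone ($\langle F(x)-F(y),x-y\rangle\ge0$ for all $x,y$) and Lipschitz continuous with constant $L>0$, and assume the solution set $S$ of the variational inequality ''find $x^*\in C$ with $\langle F(x^* ),x-x^*\rangle\ge0$ for all $x\in C$'' is nonempty. Then any sequences $(x_n)$ and $(y_n)$ generated by Algorithm A (described below) converge weakly to a solution of this variational inequality.
   Context: Convention: $0/0=+\infty$ and $1/0=+\infty$. $P_C$ is the metric projection onto $C$. Algorithm A: Step 1. Choose $x_0\in C$, $\lambda_{-1}>0$, $\theta_0=1$, $\alpha\in(0,\sqrt2-1)$ and $\bar\lambda>0$. Compute $y_0=P_C(x_0-\lambda_{-1}F(x_0))$, $\lambda_0=\min\{\alpha\|x_0-y_0\|/\|F(x_0)-F(y_0)\|,\bar\lambda\}$, $x_1=P_C(x_0-\lambda_0F(y_0))$. Step 2 (for $n\ge1$). Set $\theta_n=1$ and define, for $y\in H$, $\theta>0$, $\lambda(y,\theta)=\min\{\alpha\|y-y_{n-1}\|/\|F(y)-F(y_{n-1})\|,\ \frac{1+\theta_{n-1}}{\theta}\lambda_{n-1},\ \bar\lambda\}$. Compute $y_n=2x_n-x_{n-1}$, $\lambda_n=\lambda(y_n,\theta_n)$, $x_{n+1}=P_C(x_n-\lambda_nF(y_n))$. Step 3. If $\|y_n-P_C(x_n-\lambda_nF(y_n))\|+\|x_n-y_n\|=0$, stop ($x_n$ is a solution). Otherwise compute $t_n=-\|x_{n+1}-x_n\|^2+2\lambda_n\langle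 F(y_n),y_n-x_{n+1}\rangle+(1-\alpha(1+\sqrt2))\|x_n-y_n\|^2-\alpha\|x_n-y_{n-1}\|^2+(1-\sqrt2\alpha)\|x_{n+1}-y_n\|^2$. Step 4. If $t_n\le0$, go to Step 2 with $n:=n+1$. Otherwise: (i) if $\lambda_n\ge\lambda_{n-1}$, choose $\lambda_n'\in[\lambda_{n-1},\lambda_n]$ with $\|\lambda_n'F(y_n)-\lambda_{n-1}F(y_{n-1})\|\le\alpha\|y_n-y_{n-1}\|$, recompute $x_{n+1}=P_C(x_n-\lambda_n'F(y_n))$, set $\lambda_n:=\lambda_n'$, $n:=n+1$, go to Step 2; (ii) if $\lambda_n<\lambda_{n-1}$, find $\theta_n'\in(0,1]$ such that, with $y_n'=x_n+\theta_n'(x_n-x_{n-1})$, one has $\lambda(y_n',\theta_n')\ge\theta_n'\lambda_{n-1}$; then choose $\lambda_n'\in[\theta_n'\lambda_{n-1},\lambda(y_n',\theta_n')]$ with $\|\lambda_n'F(y_n')-\theta_n'\lambda_{n-1}F(y_{n-1})\|\le\alpha\|y_n'-y_{n-1}\|$, recompute $x_{n+1}=P_C(x_n-\lambda_n'F(y_n'))$, set $\lambda_n:=\lambda_n'$, $\theta_n:=\theta_n'$, $y_n:=y_n'$, $n:=n+1$, go to Step 2. The sequences $(x_n)$, $(y_n)$ refer to the final values after any modification in Step 4. *)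

(* Defs.v *)
From HB Require Import structures.
From mathcomp Require Import all_boot all_order all_algebra.
From mathcomp Require Import reals.
Set Implicit Arguments. Unset Strict Implicit. Unset Printing Implicit Defensive.
Import Order.TTheory GRing.Theory Num.Theory.
Local Open Scope ring_scope.

Section Hilbert.
Variables (R : realType) (V : lmodType R) (ip : V -> V -> R).

Definition inner_product : Prop :=
  (forall x y, ip x y = ip y x) /\
  (forall (a : R) x y z, ip (a *: x + y) z = a * ip x z + ip y z) /\
  (forall x, 0 <= ip x x) /\
  (forall x, ip x x = 0 -> x = 0).

Definition hnorm (x : V) : R := Num.sqrt (ip x x).

Definition cauchy_seq (u : nat -> V) : Prop :=
  forall eps : R, 0 < eps -> exists N : nat, forall m n : nat,
    (N <= m)%N -> (N <= n)%N -> hnorm (u m - u n) < eps.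

Definition strong_cvg (u : nat -> V) (l : V) : Prop :=
  forall eps : R, 0 < eps -> exists N : nat, forall n : nat,
    (N <= n)%N -> hnorm (u n - l) < eps.

Definition weak_cvg (u : nat -> V) (l : V) : Prop :=
  forall z : V, forall eps : R, 0 < eps -> exists N : nat, forall n : nat,
    (N <= n)%N -> `|ip (u n) z - ip l z| < eps.

Definition complete_space : Prop :=
  forall u : nat -> V, cauchy_seq u -> exists l, strong_cvg u l.

Definition real_hilbert_space : Prop := inner_product /\ complete_space.

Definition closed_set (C : V -> Prop) : Prop :=
  forall (u : nat -> V) (l : V), (forall n, C (u n)) -> strong_cvg u l -> C l.

Definition convex_set (C : V -> Prop) : Prop :=
  forall x y (t : R), C x -> C y -> 0 <= t <= 1 -> C (t *: x + (1 - t) *: y).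

Definition is_metric_proj (C : V -> Prop) (x p : V) : Prop :=
  C p /\ forall z, C z -> hnorm (x - p) <= hnorm (x - z).

Definition monotone_op (F : V -> V) : Prop :=
  forall x y, 0 <= ip (F x - F y) (x - y).

Definition lipschitz_op (F : V -> V) (L : R) : Prop :=
  forall x y, hnorm (F x - F y) <= L * hnorm (x - y).

Definition vi_solution (C : V -> Prop) (F : V -> V) (xs : V) : Prop :=
  C xs /\ forall x, C x -> 0 <= ip (F xs) (x - xs).

Variables (P : V -> V) (F : V -> V) (alpha lambar : R).

(* min{ a, b } where a = alpha*||u-v||/||F u - F v|| with the convention
   0/0 = 1/0 = +oo (i.e. the quotient is ignored when F u = F v) *)
Definition min_ratio (u v : V) (b : R) : R :=
  if F u == F v then b
  else Num.min (alpha * hnorm (u - v) / hnorm (F u - F v)) b.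

Definition lam_fun (yprev : V) (thprev lamprev : R) (yv : V) (th : R) : R :=
  min_ratio yv yprev (Num.min ((1 + thprev) / th * lamprev) lambar).

Definition algA_init (lam_m1 : R) (x y : nat -> V) (lam theta : nat -> R)
  : Prop :=
  theta 0%N = 1 /\
  y 0%N = P (x 0%N - lam_m1 *: F (x 0%N)) /\
  lam 0%N = min_ratio (x 0%N) (y 0%N) lambar /\
  x 1%N = P (x 0%N - lam 0%N *: F (y 0%N)).

(* Steps 2-4 for an index n >= 1, producing the final values
   theta n, y n, lam n, x (n+1); the run never stops at Step 3 *)
Definition algA_step (x y : nat -> V) (lam theta : nat -> R) (n : nat)
  : Prop :=
  let lf := lam_fun (y n.-1) (theta n.-1) (lam n.-1) in
  let yt := 2%:R *: x n - x n.-1 in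
  let lt := lf yt 1 in
  let xt := P (x n - lt *: F yt) in
  let s2 := Num.sqrt (2%:R : R) in
  let t := - hnorm (xt - x n) ^+ 2 + 2%:R * lt * ip (F yt) (yt - xt)
           + (1 - alpha * (1 + s2)) * hnorm (x n - yt) ^+ 2
           - alpha * hnorm (x n - y n.-1) ^+ 2
           + (1 - s2 * alpha) * hnorm (xt - yt) ^+ 2 in
  (* Step 3: stopping criterion not met *)
  hnorm (yt - xt) + hnorm (x n - yt) <> 0 /\
  (
    (t <= 0 /\ theta n = 1 /\ y n = yt /\ lam n = lt /\ x n.+1 = xt)
  \/
    (0 < t /\ lam n.-1 <= lt /\ theta n = 1 /\ y n = yt /\
     lam n.-1 <= lam n <= lt /\
     hnorm (lam n *: F yt - lam n.-1 *: F (y n.-1))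
       <= alpha * hnorm (yt - y n.-1) /\
     x n.+1 = P (x n - lam n *: F yt))
  \/
    (0 < t /\ lt < lam n.-1 /\ 0 < theta n <= 1 /\
     y n = x n + theta n *: (x n - x n.-1) /\
     theta n * lam n.-1 <= lf (y n) (theta n) /\
     theta n * lam n.-1 <= lam n <= lf (y n) (theta n) /\
     hnorm (lam n *: F (y n) - (theta n * lam n.-1) *: F (y n.-1))
       <= alpha * hnorm (y n - y n.-1) /\
     x n.+1 = P (x n - lam n *: F (y n))) ).

Definition algA_run (lam_m1 : R) (x y : nat -> V) (lam theta : nat -> R)
  : Prop :=
  algA_init lam_m1 x y lam theta /\
  forall n : nat, (1 <= n)%N -> algA_step x y lam theta n.

End Hilbert.

(* Main.v *)
Require Import Defs.
From mathcomp Require Import all_boot all_order all_algebra.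
From mathcomp Require Import reals boolp classical_sets.
From mathcomp Require Import topology normedtype sequences.
From mathcomp Require Import ring lra.
Set Implicit Arguments. Unset Strict Implicit. Unset Printing Implicit Defensive.
Import Order.TTheory GRing.Theory Num.Theory.
Import numFieldNormedType.Exports.
Local Open Scope classical_set_scope.
Local Open Scope ring_scope.

(* The quantity |x_(n+1) - z|^2 + alpha |x_(n+1) - y_n|^2
   + 2 (1 + theta_n) lambda_n <F z, x_n - z> is a Lyapunov function for every
   solution z: when t_n <= 0 by definition of t_n, and after a correction by the
   projection inequalities at x_n tested against x_(n-1) and x_(n+1). Hence
   |x_n - y_n|, |x_(n+1) - y_n| and |x_(n+1) - x_n| tend to 0.
   Since theta_n' may be arbitrarily small, lambda_n need not be bounded away from
   0, so these limits do not directly control p_n = (x_n - x_(n+1)) / lambda_n.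
   But a small lambda_n can only increase at the next step, and meanwhile the
   monotonicity of F makes (1 - 4 L lambda_n) (|p|^2 / 2 - <e, p> + 2 |e|^2)
   nonincreasing, where e_n = F y_n - F x_(n+1); when lambda drops, |p| grows by at
   most |e_n| + |e_(n+1)|. So p_n -> 0, which yields limsup <F w, x_n - w> <= 0 for w
   in C. Cluster points are then solutions by Minty's lemma, |x_n - z| converges
   for every solution z, and Opial's lemma applies.
   Weak compactness is replaced by the notion [weak_cluster], which mentions
   neither subsequences nor the dual space. *)

(** * Inner product calculus and the metric projection *)

Section InnerProduct.
Context {R : realType} {V : lmodType R} (ip : V -> V -> R).
Hypothesis ipP : inner_product ip.
Implicit Types (x y z u v w : V) (a b c : R).

Lemma ipC x y : ip x y = ip y x.
Proof. by case: ipP. Qed.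

Lemma ipDl x y z : ip (x + y) z = ip x z + ip y z.
Proof. by case: ipP => _ [lin _]; rewrite -[x]scale1r lin mul1r scale1r. Qed.

Lemma ip0l z : ip 0 z = 0.
Proof. by apply: (addrI (ip 0 z)); rewrite -ipDl !addr0. Qed.

Lemma ipZl a x z : ip (a *: x) z = a * ip x z.
Proof. by case: ipP => _ [lin _]; rewrite -[a *: x]addr0 lin ip0l addr0. Qed.

Lemma ipNl x z : ip (- x) z = - ip x z.
Proof. by rewrite -scaleN1r ipZl mulN1r. Qed.

Lemma ipDr x y z : ip x (y + z) = ip x y + ip x z.
Proof. by rewrite ipC ipDl !(ipC x). Qed.

Lemma ipZr a x z : ip x (a *: z) = a * ip x z.
Proof. by rewrite ipC ipZl (ipC x). Qed.

Lemma ipNr x z : ip x (- z) = - ip x z.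
Proof. by rewrite ipC ipNl (ipC x). Qed.

Definition ipE := (ipDl, ipDr, ipNl, ipNr, ipZl, ipZr).

Lemma ip_ge0 x : 0 <= ip x x.
Proof. by case: ipP => _ [_ [+ _]]. Qed.

Lemma ip_eq0 x : ip x x = 0 -> x = 0.
Proof. by case: ipP => _ [_ [_]]; apply. Qed.

Lemma hnorm_ge0 x : 0 <= hnorm ip x.
Proof. exact: sqrtr_ge0. Qed.

Lemma sqr_hnorm x : hnorm ip x ^+ 2 = ip x x.
Proof. by rewrite sqr_sqrtr // ip_ge0. Qed.

Lemma hnorm_le x b : 0 <= b -> ip x x <= b ^+ 2 -> hnorm ip x <= b.
Proof. by move=> b0 xb; rewrite -(ger0_norm b0) -sqrtr_sqr ler_wsqrtr. Qed.

Lemma hnormZ a x : hnorm ip (a *: x) = `|a| * hnorm ip x.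
Proof. by rewrite /hnorm !ipE mulrA -expr2 sqrtrM ?sqr_ge0 // sqrtr_sqr. Qed.

Lemma hnormN x : hnorm ip (- x) = hnorm ip x.
Proof. by rewrite -scaleN1r hnormZ normrN1 mul1r. Qed.

Lemma hnormB x y : hnorm ip (x - y) = hnorm ip (y - x).
Proof. by rewrite -hnormN opprB. Qed.

Lemma hnorm0 : hnorm ip 0 = 0.
Proof. by rewrite /hnorm ip0l sqrtr0. Qed.

Lemma hnorm_gt0 x : x != 0 -> 0 < hnorm ip x.
Proof.
move=> x0; rewrite lt_neqAle hnorm_ge0 andbT eq_sym.
by apply: contra x0 => /eqP hx; apply/eqP/ip_eq0; rewrite -sqr_hnorm hx expr0n.
Qed.

(** With [a], [b] the two norms, [|b x - a y|^2 = 2 a b (a b - <x, y>)], which is divided by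
    [a b > 0]. *)
Lemma cauchy_schwarz x y : ip x y <= hnorm ip x * hnorm ip y.
Proof.
have [->|/hnorm_gt0 x0] := eqVneq x 0; first by rewrite ip0l hnorm0 mul0r.
have [->|/hnorm_gt0 y0] := eqVneq y 0; first by rewrite ipC ip0l hnorm0 mulr0.
set a := hnorm ip x in x0 *; set b := hnorm ip y in y0 *.
have := ip_ge0 (b *: x - a *: y).
rewrite !ipE -!sqr_hnorm -/a -/b (ipC y x) => h.
rewrite -(ler_pM2l (mulr_gt0 x0 y0)); nra.
Qed.

Lemma ip_ge x y : - (hnorm ip x * hnorm ip y) <= ip x y.
Proof. by rewrite lerNl -ipNl -(hnormN x) cauchy_schwarz. Qed.

Lemma normr_ip x y : `|ip x y| <= hnorm ip x * hnorm ip y.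
Proof. by rewrite ler_norml ip_ge cauchy_schwarz. Qed.

Lemma hnormD x y : hnorm ip (x + y) <= hnorm ip x + hnorm ip y.
Proof.
apply: hnorm_le; first by rewrite addr_ge0 ?hnorm_ge0.
rewrite !ipE (ipC y x) -!sqr_hnorm; have := cauchy_schwarz x y; nra.
Qed.


Lemma metric_proj_le0 (C : V -> Prop) z p w : convex_set C ->
  is_metric_proj ip C z p -> C w -> ip (z - p) (w - p) <= 0.
Proof.
move=> cC [Cp minp] Cw; rewrite leNgt; apply/negP => a0.
set a := ip (z - p) (w - p) in a0.
have b0 : 0 <= ip (w - p) (w - p) by exact: ip_ge0.
set b := ip (w - p) (w - p) in b0.
have ab0 : 0 < a + b by rewrite ltr_wpDr.
(* This [t] lies in (0, 1] even if [b = 0], and [t b = a - t a < 2 a] makes the point at parameter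
   [t] strictly closer to [z] than [p]. *)
pose t := a / (a + b).
have t01 : 0 < t <= 1 by rewrite divr_gt0 //= ler_pdivrMr // mul1r lerDl.
have tab : t * (a + b) = a by rewrite mulfVK // gt_eqF.
have /andP[t0 t1] := t01.
have Cv : C (t *: w + (1 - t) *: p) by apply: cC => //; rewrite t1 ltW.
have := minp _ Cv; rewrite -(ler_pXn2r (n := 2)) ?nnegrE ?hnorm_ge0 //.
have -> : z - (t *: w + (1 - t) *: p) = (z - p) - t *: (w - p).
  by rewrite scalerBl scale1r scalerBr addrCA opprD addrA.
move: (z - p) (w - p) @a @b a0 b0 ab0 @t t01 tab t0 t1 {Cv}.
move=> u v a b a0 b0 ab0 t t01 tab t0 t1.
rewrite !sqr_hnorm !ipE (ipC v) -/a -/b.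
suff : 0 < 2 * a - t * b by nra.
nra.
Qed.

(** * Weak cluster points and Opial's lemma *)

(** The intersection of the closed convex hulls of the tails of [u]. It can exceed the set of usual
    weak cluster points: 0 qualifies for a sequence alternating between [v] and [- v]. *)
Definition weak_cluster (u : nat -> V) (q : V) : Prop :=
  forall D, closed_set ip D -> convex_set D -> (\forall n \near \oo, D (u n)) ->
  D q.

Lemma parallelogram x y : ip (x - y) (x - y) =
  2 * ip x x + 2 * ip y y - 4 * ip (2^-1 *: x + (1 - 2^-1) *: y)
                                  (2^-1 *: x + (1 - 2^-1) *: y).
Proof. by rewrite !ipE (ipC y x); field. Qed.

(* The cluster point is the limit of almost minimal-norm points of a decreasing
   sequence of closed convex sets whose norm bounds exhaust the supremum. *)
Lemma weak_cluster_exists (u : nat -> V) (M : R) : complete_space ip ->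
  (forall n, hnorm ip (u n) <= M) -> exists q, weak_cluster u q.
Proof.
move=> complV uM.
pose fam (D : V -> Prop) :=
  [/\ closed_set ip D, convex_set D & \forall n \near \oo, D (u n)].
pose E : set R := [set r | exists2 D, fam D & forall v, D v -> r <= hnorm ip v].
have E0 : E 0.
  exists (fun=> True); last by move=> v _; exact: hnorm_ge0.
  by split=> //; near=> n.
have EM : ubound E M.
  move=> r [D [_ _ [n _ Dn]] Dr]; apply: le_trans (uM n); apply: Dr.
  by apply: Dn => /=.
have supE : has_sup E by split; [exists 0 | exists M].
set d := sup E.
have d0 : 0 <= d by apply: ub_le_sup => //; exists M.
pose eta (k : nat) : R := k.+1%:R^-1.
have eta0 k : 0 < eta k by rewrite invr_gt0.
have eta_anti j k : (j <= k)%N -> eta k <= eta j.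
  by move=> jk; rewrite lef_pV2 ?posrE // ler_nat.
have /choice[D D_] : forall k, exists D : V -> Prop,
    fam D /\ forall v, D v -> d - eta k <= hnorm ip v.
  move=> k; have [r [D famD Dr] dr] := sup_adherent (eta0 k) supE.
  by exists D; split=> // v Dv; apply: le_trans (ltW dr) (Dr v Dv).
have near_min G k : fam G -> exists2 v, G v & hnorm ip v < d + eta k.
  move=> famG; apply: contrapT => noG.
  suff : E (d + eta k).
    by move/(ub_le_sup (ex_intro _ M EM)); rewrite -/d gerDl leNgt eta0.
  exists G => // v Gv; rewrite leNgt; apply/negP => lv; apply: noG.
  by exists v.
pose D' k v := forall j : 'I_k.+1, D j v.
have D'_anti j k v : (j <= k)%N -> D' k v -> D' j v.
  move=> jk Dv i.
  have ik : (i < k.+1)%N by exact: leq_trans (ltn_ord i) _.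
  exact: (Dv (Ordinal ik)).
have famI G k : fam G -> fam (fun v => G v /\ D' k v).
  move=> [Gcl Gcv Gu]; split.
  - move=> w l Gw wl; split; first by apply: Gcl wl => n; case: (Gw n).
    move=> j; have [[+ _ _] _] := D_ j; apply; last exact: wl.
    by move=> n; have [_] := Gw n; exact.
  - move=> a b t [Ga Da] [Gb Db] t01; split; first exact: Gcv.
    by move=> j; have [[_ + _] _] := D_ j; apply.
  - suff uD : \forall n \near \oo, D' k (u n) by near do split.
    apply: (@filter_forall _ _ (fun (j : 'I_k.+1) n => D j (u n))) => j.
    by have [[_ _]] := D_ j.
(* Parallelogram law: with [h = eta k <= 1] and [t] the norm of the midpoint, the squared distance
   is at most [4 ((d + h)^2 - t^2) <= 16 h (d + 1)]. *)
have key (e : R) : 0 < e -> exists K, forall k v w, (K <= k)%N -> D' k v -> D' k w ->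
    hnorm ip v < d + eta k -> hnorm ip w < d + eta k -> hnorm ip (v - w) < e.
  move=> e0; have x0 : 0 <= 16 * (d + 1) / e ^+ 2.
    by rewrite divr_ge0 ?sqr_ge0 // mulr_ge0 // addr_ge0.
  exists (Num.bound (16 * (d + 1) / e ^+ 2)) => k v w Kk Dv Dw vd wd.
  have : 16 * (d + 1) / e ^+ 2 < k.+1%:R.
    by apply: lt_le_trans (archi_boundP x0) _; rewrite ler_nat ltnW.
  rewrite ltr_pdivrMr ?exprn_gt0 // -ltr_pdivrMl // -/(eta k) => etae.
  have eta1 : eta k <= 1 by rewrite invf_le1 // ler1n.
  have Dm : D' k (2^-1 *: v + (1 - 2^-1) *: w).
    by move=> j; have [[_ + _] _] := D_ j; apply=> //; lra.
  have md : d - eta k <= hnorm ip (2^-1 *: v + (1 - 2^-1) *: w).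
    by have [_ +] := D_ k; apply; exact: (Dm ord_max).
  rewrite -(ltr_pXn2r (n := 2)) ?nnegrE ?hnorm_ge0 ?ltW //; apply: le_lt_trans etae.
  rewrite sqr_hnorm parallelogram -!sqr_hnorm.
  move: md (hnorm_ge0 v) (hnorm_ge0 w) (eta0 k) vd wd.
  have := hnorm_ge0 (2^-1 *: v + (1 - 2^-1) *: w).
  move: (hnorm ip v) (hnorm ip w) (hnorm ip _) (eta k) eta1 => r s t h *.
  have rh : r ^+ 2 <= (d + h) ^+ 2 by rewrite ler_pXn2r ?nnegrE //; lra.
  have sh : s ^+ 2 <= (d + h) ^+ 2 by rewrite ler_pXn2r ?nnegrE //; lra.
  (* Squaring [d - h <= t] would fail for [d < h]; instead [(d + h)^2 - t^2] is factored and
     [d + h - t] is bounded by [2 h]. *)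
  have [td|dt] := leP (d + h) t.
    have : (d + h) ^+ 2 <= t ^+ 2 by rewrite ler_pXn2r ?nnegrE //; lra.
    by nra.
  have : (d + h) ^+ 2 - t ^+ 2 <= 2 * h * (2 * (d + h)) by nra.
  by nra.
have famT : fam (fun=> True) by split=> //; near=> n.
have /choice[v v_] : forall k, exists v, D' k v /\ hnorm ip v < d + eta k.
  by move=> k; have [v [_ Dv] vd] := near_min _ k (famI _ k famT); exists v.
have [q vq] : exists q, strong_cvg ip v q.
  apply: complV => e /key[K keyK]; exists K => m n Km Kn.
  have [Dm vm] := v_ m; have [Dn vn] := v_ n.
  apply: keyK (leqnn K) (D'_anti _ _ _ Km Dm) (D'_anti _ _ _ Kn Dn) _ _.
    by apply: lt_le_trans vm _; rewrite lerD2l eta_anti.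
  by apply: lt_le_trans vn _; rewrite lerD2l eta_anti.
exists q => G Gcl Gcv Gu.
(* Almost minimal points of the intersection of [G] and [D' k] are close to [v k] by [key], so they
   also tend to [q], and [G] is closed. *)
have /choice[w w_] : forall k, exists w, (G w /\ D' k w) /\
    hnorm ip w < d + eta k.
  move=> k; have famG : fam G by [].
  by have [w Gw wd] := near_min _ k (famI _ k famG); exists w.
apply: (Gcl w q) => [n|e e0]; first by have [[]] := w_ n.
have [|K keyK] := key (e / 2); first by rewrite divr_gt0.
have [|N vN] := vq (e / 2); first by rewrite divr_gt0.
exists (maxn K N) => n; rewrite geq_max => /andP[Kn Nn].
have [[_ Dwn] wn] := w_ n; have [Dvn vn] := v_ n.
rewrite -(subrK (v n) (w n)) -addrA; apply: le_lt_trans (hnormD _ _) _.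
by have := vN n Nn; have := keyK n _ _ Kn Dwn Dvn wn vn; lra.
Unshelve. all: by end_near.
Qed.

(** A closed half-space is an admissible test set for [weak_cluster]. *)
Lemma weak_cluster_le (u : nat -> V) q z b : weak_cluster u q ->
  (\forall n \near \oo, ip (u n) z <= b) -> ip q z <= b.
Proof.
move/(_ (fun w => ip w z <= b)); apply=> [w l wb wl|x1 x2 t x1b x2b /andP[t0 t1]];
  last by rewrite !ipE; nra.
apply/ler_addgt0Pr => e e0.
have z1 : 0 < hnorm ip z + 1 by rewrite ltr_wpDl ?hnorm_ge0.
have [N /(_ N (leqnn N)) wN] := wl _ (divr_gt0 e0 z1).
have := ip_ge (w N - l) z; rewrite ipDl ipNl.
have : hnorm ip (w N - l) * hnorm ip z <= e.
  move: wN; rewrite ltr_pdivlMr //; have := hnorm_ge0 (w N - l).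
  by have := hnorm_ge0 z; nra.
by have := wb N; lra.
Qed.

Lemma weak_cluster_lim (u : nat -> V) q z (l : R) : weak_cluster u q ->
  (fun n => ip (u n) z) @ \oo --> l -> ip q z = l.
Proof.
move=> uq ul; apply: le_anti; apply/andP; split; apply/ler_addgt0Pr => e e0.
  apply: weak_cluster_le uq _; apply: cvgr_le ul _ _; first by rewrite ltrDl.
suff : ip q (- z) <= e - l by rewrite ipNr; lra.
apply: weak_cluster_le uq _.
apply: filterS _ (cvgr_ge _ ul (l - e) _) => [n|]; last by rewrite ltrBlDr ltrDl.
by rewrite ipNr; lra.
Qed.

(* Opial's lemma: two cluster points of subsequences in [S] coincide because
   the difference of the squared distances to them is affine in [u n]. *)
Lemma opial (S : V -> Prop) (u : nat -> V) (M : R) : complete_space ip ->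
  (forall n, hnorm ip (u n) <= M) ->
  (forall z, S z -> cvgn (fun n => ip (u n - z) (u n - z))) ->
  (forall f q, (forall n, (n <= f n)%N) -> weak_cluster (u \o f) q -> S q) ->
  exists2 q, S q & weak_cvg ip u q.
Proof.
move=> complV uM cvgS clusterS.
have [q uq] := weak_cluster_exists complV uM.
have Sq : S q by apply: (clusterS id).
exists q => //.
(* If this one-sided bound failed, it would fail along some [f], and a cluster point [q'] of
   [u \o f] would have to equal [q]. The bounds for [v] and [- v] give weak convergence. *)
have half v e : 0 < e -> \forall n \near \oo, ip (u n) v - ip q v < e.
  move=> e0; apply: contrapT => notnear.
  have /choice[f f_] : forall N, exists n, (N <= n)%N /\
      e <= ip (u n) v - ip q v.
    move=> N; apply: contrapT => nof; apply: notnear.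
    exists N => // n /= Nn; rewrite ltNge; apply/negP => ne; apply: nof.
    by exists n.
  have fn n : (n <= f n)%N by case: (f_ n).
  have [q' ufq'] := weak_cluster_exists complV (fun n => uM (f n)).
  have Sq' : S q' by apply: clusterS ufq'.
  have foo : f @ \oo --> \oo.
    by apply/cvgnyPge => N; exists N => // n /= Nn; apply: leq_trans (fn n).
  have /cvg_ex[l ul] : cvgn (fun n => ip (u n) (q' - q)).
    have -> : (fun n => ip (u n) (q' - q)) = (fun n => 2^-1 *
        (ip (u n - q) (u n - q) - ip (u n - q') (u n - q') + (ip q' q' - ip q q))).
      by apply/funext => n; rewrite !ipE !(ipC q) !(ipC q'); field.
    have cvgBS : cvgn (fun n => ip (u n - q) (u n - q) - ip (u n - q') (u n - q')).
      exact: is_cvgB (cvgS _ Sq) (cvgS _ Sq').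
    have cvgBSD : cvgn (fun n => ip (u n - q) (u n - q) - ip (u n - q') (u n - q') +
        (ip q' q' - ip q q)) by exact: is_cvgD cvgBS (is_cvg_cst _).
    exact: is_cvgM (is_cvg_cst _) cvgBSD.
  have ufl : (fun n => ip ((u \o f) n) (q' - q)) @ \oo --> l.
    exact: (cvg_comp _ _ foo ul).
  (* Both [<q, q' - q>] and [<q', q' - q>] equal the limit [l]. *)
  have qq' : q' - q = 0.
    apply: ip_eq0; rewrite ipDl ipNl (weak_cluster_lim ufq' ufl).
    by rewrite (weak_cluster_lim uq ul) subrr.
  suff : ip q' (- v) <= - (e + ip q v).
    by rewrite (subr0_eq qq') ipNr lerN2; lra.
  apply: weak_cluster_le ufq' _; near=> n; have [_] := f_ n.
  by rewrite ipNr /=; lra.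
move=> v e e0.
suff [N _ uN] : \forall n \near \oo, `|ip (u n) v - ip q v| < e.
  by exists N => n Nn; exact: uN.
apply: filterS2 _ (half v e e0) (half (- v) e e0) => n.
by rewrite !ipNr ltr_norml => -> h; rewrite andbT; lra.
Unshelve. all: by end_near.
Qed.

(** * One-step estimates for the Lyapunov function *)

(** Young's inequality [2 (c + d) b <= s b^2 + (s / 2) (c + d)^2], followed by
    [(s / 2) (c + d)^2 <= (1 + s) c^2 + d^2]. The resulting weights are those of [t_n]. *)
Lemma sqrt2_weighted_amgm (s a b c d : R) : 0 <= s -> s ^+ 2 = 2 -> 0 <= b ->
  a <= c + d -> 2 * (a * b) <= (1 + s) * c ^+ 2 + d ^+ 2 + s * b ^+ 2.
Proof.
move=> s0 s2 b0 acd.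
have s_le2 : s <= 2 by nra.
have sqr1 : 0 <= s * (b - s / 2 * (c + d)) ^+ 2 by rewrite mulr_ge0 ?sqr_ge0.
have sqr2 : 0 <= (1 - s / 2) * (d - (1 + s) * c) ^+ 2.
  by rewrite mulr_ge0 ?sqr_ge0 //; lra.
(* The last summand collects the multiples of [s^2 - 2], so that the identity holds for every
   [s]. *)
have sos : (1 + s) * c ^+ 2 + d ^+ 2 + s * b ^+ 2 = 2 * ((c + d) * b) +
    s * (b - s / 2 * (c + d)) ^+ 2 + (1 - s / 2) * (d - (1 + s) * c) ^+ 2 -
    (s ^+ 2 - 2) * (s / 4 * (c + d) ^+ 2 - (c + d) * b + c * d - s / 2 * c ^+ 2).
  by field.
rewrite s2 subrr mul0r subr0 in sos.
have := ler_wpM2r b0 acd; lra.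
Qed.

(** The projection inequalities at [x1] bound [theta lam0 <g0, y1 - x2>]; the hypothesis on
    [lam1 g1 - theta lam0 g0] transfers this to [lam1 g1] by Cauchy-Schwarz and the weighted
    inequality above. *)
Lemma extrapolation_descent (s alpha lam0 lam1 theta : R) x0 x1 x2 y0 y1 g0 g1 :
  0 <= s -> s ^+ 2 = 2 -> 0 <= alpha -> 0 <= theta ->
  y1 = x1 + theta *: (x1 - x0) ->
  ip (x0 - lam0 *: g0 - x1) (x0 - x1) <= 0 ->
  ip (x0 - lam0 *: g0 - x1) (x2 - x1) <= 0 ->
  hnorm ip (lam1 *: g1 - (theta * lam0) *: g0) <= alpha * hnorm ip (y1 - y0) ->
  - ip (x2 - x1) (x2 - x1) + 2 * lam1 * ip g1 (y1 - x2) +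
    (1 - alpha * (1 + s)) * ip (x1 - y1) (x1 - y1) - alpha * ip (x1 - y0) (x1 - y0) +
    (1 - s * alpha) * ip (x2 - y1) (x2 - y1) <= 0.
Proof.
move=> s0 s2 a0 t0 def_y p0 p2 gap.
have proj : 2 * (theta * lam0) * ip g0 (y1 - x2) <=
    ip (x2 - x1) (x2 - x1) - ip (x1 - y1) (x1 - y1) - ip (x2 - y1) (x2 - y1).
  (* As [y1 - x2 = (x1 - x2) + theta (x1 - x0)], the tests against [x2] and [x0] enter with weights
     [theta] and [theta^2]. *)
  move: (mulr_ge0_le0 t0 p2) (mulr_ge0_le0 (mulr_ge0 t0 t0) p0).
  rewrite def_y !ipE !(ipC _ x0) !(ipC _ x1) (ipC _ x2); nra.
have cs : 2 * ip (lam1 *: g1 - (theta * lam0) *: g0) (y1 - x2) <=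
    alpha * (2 * (hnorm ip (y1 - y0) * hnorm ip (y1 - x2))).
  have := cauchy_schwarz (lam1 *: g1 - (theta * lam0) *: g0) (y1 - x2).
  have := ler_wpM2r (hnorm_ge0 (y1 - x2)) gap; nra.
have tri : hnorm ip (y1 - y0) <= hnorm ip (x1 - y1) + hnorm ip (x1 - y0).
  rewrite (hnormB x1 y1); apply: le_trans (hnormD _ _).
  by rewrite addrA subrK.
have := ler_wpM2l a0 (sqrt2_weighted_amgm s0 s2 (hnorm_ge0 (y1 - x2)) tri).
rewrite (hnormB y1 x2) in cs *; rewrite !sqr_hnorm => amgm.
move: cs; rewrite (ipDl (lam1 *: g1)) (ipNl (_ *: g0)) !ipZl; lra.
Qed.

(** Extrapolation gives [<gz, y1 - z> = (1 + theta) <gz, x1 - z> - theta <gz, x0 - z>]; the bound on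
    [theta lam1] absorbs the negative part into the previous dual term. The weight [1 - s alpha]
    splits as [alpha] plus [1 - alpha (1 + s)]. *)
Lemma lyapunov_step (s alpha lam0 lam1 theta0 theta : R) z gz x0 x1 x2 y0 y1 g1 :
  0 <= s -> 0 <= alpha -> 0 <= lam1 -> theta * lam1 <= (1 + theta0) * lam0 ->
  y1 = x1 + theta *: (x1 - x0) ->
  0 <= ip gz (x0 - z) -> 0 <= ip (g1 - gz) (y1 - z) ->
  ip (x1 - lam1 *: g1 - x2) (z - x2) <= 0 ->
  - ip (x2 - x1) (x2 - x1) + 2 * lam1 * ip g1 (y1 - x2) +
    (1 - alpha * (1 + s)) * ip (x1 - y1) (x1 - y1) - alpha * ip (x1 - y0) (x1 - y0) +
    (1 - s * alpha) * ip (x2 - y1) (x2 - y1) <= 0 ->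
  ip (x2 - z) (x2 - z) + alpha * ip (x2 - y1) (x2 - y1) +
    2 * ((1 + theta) * lam1 * ip gz (x1 - z)) +
    (1 - alpha * (1 + s)) * (ip (x1 - y1) (x1 - y1) + ip (x2 - y1) (x2 - y1)) <=
  ip (x1 - z) (x1 - z) + alpha * ip (x1 - y0) (x1 - y0) +
    2 * ((1 + theta0) * lam0 * ip gz (x0 - z)).
Proof.
move=> s0 a0 l0 thl def_y z0 mono proj desc.
have step : ip (x2 - z) (x2 - z) + 2 * lam1 * ip gz (y1 - z) <= ip (x1 - z) (x1 - z)
    - ip (x2 - x1) (x2 - x1) + 2 * lam1 * ip g1 (y1 - x2).
  have := mulr_ge0 l0 mono; move: proj.
  rewrite !ipE !(ipC _ z) !(ipC _ x1) (ipC _ x2); nra.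
have := ler_wpM2r z0 thl; move: step.
have -> : ip gz (y1 - z) = (1 + theta) * ip gz (x1 - z) - theta * ip gz (x0 - z).
  by rewrite def_y !ipE; ring.
lra.
Qed.

(** * Convergence of the residuals to 0 *)

(** Monotonicity of [F + N_C] between [x1] and [x2]: it contains [p - (g0 - f1)] at [x1] and
    [p' - (g1 - f2)] at [x2], and [x2 - x1 = - lam1 p']. *)
Lemma residual_mono (lam0 lam1 : R) x0 x1 x2 f1 f2 g0 g1 :
  let p := lam0^-1 *: (x0 - x1) in let p' := lam1^-1 *: (x1 - x2) in
  0 < lam0 -> 0 < lam1 -> 0 <= ip (f2 - f1) (x2 - x1) ->
  ip (x0 - lam0 *: g0 - x1) (x2 - x1) <= 0 ->
  ip (x1 - lam1 *: g1 - x2) (x1 - x2) <= 0 ->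
  ip (p' - p) p' <= ip (g1 - f2 - (g0 - f1)) p'.
Proof.
move=> p p' l0 l1 mono proj1 proj2.
have def_p : x0 - x1 = lam0 *: p by rewrite scalerA divff ?gt_eqF // scale1r.
have def_p' : x1 - x2 = lam1 *: p' by rewrite scalerA divff ?gt_eqF // scale1r.
have def_p'N : x2 - x1 = - (lam1 *: p') by rewrite -def_p' opprB.
have {mono} : ip (f2 - f1) p' <= 0.
  by move: mono; rewrite def_p'N ipNr ipZr oppr_ge0 pmulr_rle0.
have {proj1} : 0 <= ip (p - g0) p'.
  move: proj1; rewrite addrAC def_p def_p'N -scalerBr ipNr oppr_le0 ipZl ipZr.
  by rewrite !pmulr_rge0.
have {proj2} : ip (p' - g1) p' <= 0.
  by move: proj2; rewrite addrAC def_p' -scalerBr ipZl ipZr !pmulr_rle0.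
rewrite !ipE; lra.
Qed.

Lemma residual_growth p p' e e' : ip (p' - p) p' <= ip (e' - e) p' ->
  hnorm ip p' <= hnorm ip p + (hnorm ip e + hnorm ip e').
Proof.
move=> mono; have [->|/hnorm_gt0 p'0] := eqVneq p' 0.
  by rewrite hnorm0 !addr_ge0 ?hnorm_ge0.
rewrite -(ler_pM2r p'0) -expr2 sqr_hnorm.
have := cauchy_schwarz p p'; have := cauchy_schwarz e' p'; have := ip_ge e p'.
by move: mono; rewrite !ipDl !ipNl; nra.
Qed.

(** Polarizing [residual_mono] with [q = p' - p] bounds the increase of the first two terms by
    [- |q|^2 / 2 - <e, q>]. The term [2 |e|^2] pays for [<e, q>] and makes the whole comparable to
    [|p|^2]. *)
Definition potential p e : R := 2^-1 * ip p p - ip e p + 2 * ip e e.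

Lemma potential_ge p e : 4^-1 * ip p p <= potential p e.
Proof.
have := ip_ge0 (2^-1 *: p - e); rewrite /potential !ipE (ipC p e).
by have := ip_ge0 e; lra.
Qed.

Lemma potential_le p e : potential p e <= 4 * (ip p p + ip e e).
Proof.
rewrite /potential; have := ip_ge0 (p + e); rewrite !ipE (ipC p e).
by have := ip_ge0 p; have := ip_ge0 e; lra.
Qed.

(* Summation of the errors [(L (lam1 - lam0))^2] is avoided: the factor
   [1 - 4 L lam] absorbs them since [lam] increases. *)
Lemma potential_step (L lam0 lam1 : R) p p' e e' :
  0 <= L -> 0 <= lam0 <= lam1 -> L * lam1 <= 8^-1 ->
  ip (p' - p) p' <= ip (e' - e) p' ->
  hnorm ip e' <= L * hnorm ip (lam1 *: p' - lam0 *: p) ->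
  (1 - 4 * (L * lam1)) * potential p' e' <= (1 - 4 * (L * lam0)) * potential p e.
Proof.
move=> L0 /andP[l0 l01] Ll1 mono he'.
set q := p' - p in mono.
have def_p' : p' = p + q by rewrite addrCA subrr addr0.
clearbody q; subst p'.
pose u := L * lam0; pose u' := L * lam1.
have u0 : 0 <= u by rewrite mulr_ge0.
have uu' : u <= u' by rewrite ler_wpM2l.
have u'8 : u' <= 8^-1 by [].
have {he'} he' : ip e' e' <= 2 * (u' ^+ 2 * ip q q) + 2 * ((u' - u) ^+ 2 * ip p p).
  move: he'; rewrite -(ler_pXn2r (n := 2)) ?nnegrE ?mulr_ge0 ?hnorm_ge0 //.
  rewrite exprMn !sqr_hnorm.
  have -> : lam1 *: (p + q) - lam0 *: p = lam1 *: q + (lam1 - lam0) *: p.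
    by rewrite scalerDr scalerBl addrAC addrC.
  move=> he'; apply: le_trans he' _.
  have := ip_ge0 (lam1 *: q - (lam1 - lam0) *: p).
  move/(mulr_ge0 (sqr_ge0 L)); rewrite /u /u' !ipE; nra.
have p4 := potential_ge p e.
have e'2 : potential (p + q) e' <= (1 + 16 * (u' - u) ^+ 2) * potential p e.
  have diff : potential (p + q) e' <=
      potential p e - 4^-1 * ip q q - ip e e + 2 * ip e' e'.
    have := ip_ge0 (e + 2^-1 *: q); move: mono; rewrite /potential.
    rewrite !ipE !(ipC q); lra.
  (* The [q] part of [2 |e'|^2] is absorbed by [- |q|^2 / 4] in [diff]. *)
  have u'q : 4 * (u' ^+ 2 * ip q q) <= 16^-1 * ip q q.
    have := ip_ge0 q; have : 4 * u' ^+ 2 <= 16^-1 by nra.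
    nra.
  have := ler_wpM2l (sqr_ge0 (u' - u)) p4.
  by have := ip_ge0 e; have := ip_ge0 q; lra.
have pe0 : 0 <= potential p e by apply: le_trans p4; rewrite mulr_ge0 ?invr_ge0 ?ip_ge0.
have u14 : 0 <= 1 - 4 * u' by lra.
apply: le_trans (ler_wpM2l u14 e'2) _; rewrite (mulrA (1 - 4 * u')).
apply: ler_wpM2r => //; rewrite -/u.
(* With [d = u' - u <= 1/8]: [(1 - 4 u') (1 + 2 d) <= 1 - 4 u' + 4 d = 1 - 4 u]. *)
have : 16 * (u' - u) ^+ 2 <= 2 * (u' - u) by nra.
nra.
Qed.

(** Where [lam n >= delta], [p n] is small because [lam n p n] is. A drop below [delta] costs one
    use of [residual_growth]; from there [potential_step] keeps [p] small until [lam] reaches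
    [delta] again. *)
Lemma residual_cvg0 (L delta : R) (lam : nat -> R) (p e : nat -> V) :
  0 <= L -> 0 < delta -> L * delta <= 8^-1 -> (forall n, 0 < lam n) ->
  (forall n, ip (p n.+1 - p n) (p n.+1) <= ip (e n.+1 - e n) (p n.+1)) ->
  (forall n, lam n < delta -> lam n <= lam n.+1 /\
    hnorm ip (e n.+1) <= L * hnorm ip (lam n.+1 *: p n.+1 - lam n *: p n)) ->
  (fun n => hnorm ip (e n)) @ \oo --> (0 : R) ->
  (fun n => hnorm ip (lam n *: p n)) @ \oo --> (0 : R) ->
  (fun n => hnorm ip (p n)) @ \oo --> (0 : R).
Proof.
move=> L0 d0 Ld lam0 mono slow e_cvg lp_cvg; apply/cvgr0Pnorm_lt => eps eps0.
have [unbounded|bounded] := pselect (forall N, exists2 M, (N <= M)%N & delta <= lam M).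
  (* While [lam n < delta], [|p|^2 / 8 <= 40 eta^2], and [320 < 20^2]. *)
  pose eta := eps / 20.
  have eta0 : 0 < eta by rewrite divr_gt0.
  have : \forall n \near \oo, hnorm ip (e n) <= eta by exact: cvgr_le e_cvg _ eta0.
  have : \forall n \near \oo, hnorm ip (lam n *: p n) <= delta * eta.
    exact: cvgr_le lp_cvg _ (mulr_gt0 d0 eta0).
  move=> [N1 _ lpN1] [N2 _ eN2].
  have [M] := unbounded (maxn N1 N2); rewrite geq_max => /andP[N1M N2M] dM.
  have e_le n : (M <= n)%N -> hnorm ip (e n) <= eta.
    by move=> Mn; apply: eN2; exact: leq_trans Mn.
  have fast n : (M <= n)%N -> delta <= lam n -> hnorm ip (p n) <= eta.
    move=> Mn dn; have := lpN1 n (leq_trans N1M Mn).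
    rewrite /= hnormZ gtr0_norm // => lp; rewrite -(ler_pM2l d0).
    by apply: le_trans lp; rewrite ler_wpM2r ?hnorm_ge0.
  have pot0 n : 0 <= potential (p n) (e n).
    by apply: le_trans (potential_ge _ _); rewrite mulr_ge0 ?invr_ge0 ?ip_ge0.
  (* Just after a drop [|p| <= 3 eta] and [|e| <= eta], so [potential_le] gives
     [4 (9 + 1) eta^2]. *)
  have inv n : (M <= n)%N -> delta <= lam n \/
      (1 - 4 * (L * lam n)) * potential (p n) (e n) <= 40 * eta ^+ 2.
    elim: n => [|n IHn]; first by rewrite leqn0 => /eqP M0; left; rewrite -M0.
    rewrite leq_eqVlt => /predU1P[<-|Mn]; first by left.
    have [dn|nd] := leP delta (lam n.+1); [by left | right].
    have [dn|nd'] := leP delta (lam n).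
      have pn := residual_growth (mono n).
      have := fast n Mn dn; have := e_le n Mn; have := e_le n.+1 (leqW Mn) => e1 e0 p0.
      have {pn} pn : hnorm ip (p n.+1) <= 3 * eta by lra.
      have Ll0 : 0 <= L * lam n.+1 by rewrite mulr_ge0 // ltW.
      have : potential (p n.+1) (e n.+1) <= 40 * eta ^+ 2.
        apply: le_trans (potential_le _ _) _; rewrite -!sqr_hnorm.
        have := hnorm_ge0 (p n.+1); have := hnorm_ge0 (e n.+1); nra.
      by have := pot0 n.+1; nra.
    have [lam01 en] := slow n nd'.
    have [dn|] := IHn Mn; first by rewrite ltNge dn in nd'.
    apply: le_trans; apply: potential_step (mono n) en => //.
      by rewrite lam01 ltW.
    by apply: le_trans Ld; rewrite ler_wpM2l // ltW.
  exists M => // n /= Mn; rewrite ger0_norm ?hnorm_ge0 //.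
  have [dn|nd] := leP delta (lam n).
    by apply: le_lt_trans (fast n Mn dn) _; rewrite /eta; lra.
  have [dn|invn] := inv n Mn; first by rewrite ltNge dn in nd.
  rewrite -(ltr_pXn2r (n := 2)) ?nnegrE ?hnorm_ge0 ?ltW // sqr_hnorm.
  have Ll8 : L * lam n <= 8^-1 by apply: le_trans Ld; rewrite ler_wpM2l // ltW.
  have := potential_ge (p n) (e n); have := pot0 n.
  have : 0 < eps ^+ 2 by rewrite exprn_gt0.
  move: invn; rewrite /eta; nra.
(* Otherwise [lam] is eventually nondecreasing, hence bounded below by [lam N > 0]. *)
have [N slowN] : exists N, forall n, (N <= n)%N -> lam n < delta.
  apply: contrapT => noN; apply: bounded => N; apply: contrapT => noM; apply: noN.
  by exists N => n Nn; rewrite ltNge; apply/negP => dn; apply: noM; exists n.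
have lamN n : (N <= n)%N -> lam N <= lam n.
  elim: n => [|n IHn]; first by rewrite leqn0 => /eqP->.
  rewrite leq_eqVlt => /predU1P[<-//|Nn].
  by apply: le_trans (IHn Nn) _; case: (slow n (slowN n Nn)).
have [K _ lpK] : \forall n \near \oo, hnorm ip (lam n *: p n) < lam N * eps.
  exact: cvgr_lt lp_cvg _ (mulr_gt0 (lam0 N) eps0).
exists (maxn N K) => // n /=; rewrite geq_max => /andP[Nn Kn].
have := lpK n Kn; rewrite /= ger0_norm ?hnorm_ge0 // hnormZ gtr0_norm // => lp.
rewrite -(ltr_pM2l (lam0 N)); apply: le_lt_trans lp.
by rewrite ler_wpM2r ?hnorm_ge0 // lamN.
Qed.

(** * Telescoping and Minty's lemma *)

Lemma telescope_cvg0 (a : nat -> R) (v : nat -> V) (c : R) : 0 < c -> cvgn a ->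
  (forall n, c * ip (v n) (v n) <= a n - a n.+1) ->
  (fun n => hnorm ip (v n)) @ \oo --> (0 : R).
Proof.
move=> c0 /cvg_ex[l al] va; apply/cvgr0Pnorm_lt => eps eps0.
have al1 : (fun n => a n.+1) @ \oo --> l by move: al; rewrite -cvg_shiftS.
have diff0 : (fun n => a n - a n.+1) @ \oo --> (0 : R).
  by rewrite -(subrr l); exact: cvgB al al1.
have ceps : 0 < c * eps ^+ 2 by rewrite mulr_gt0 ?exprn_gt0.
near=> n; rewrite ger0_norm ?hnorm_ge0 //.
rewrite -(ltr_pXn2r (n := 2)) ?nnegrE ?hnorm_ge0 ?ltW // sqr_hnorm.
rewrite -(ltr_pM2l c0); apply: le_lt_trans (va n) _.
by near: n; exact: cvgr_lt diff0 _ ceps.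
Unshelve. all: by end_near.
Qed.

Lemma minty (C : V -> Prop) (F : V -> V) (L : R) q : convex_set C -> 0 <= L ->
  lipschitz_op ip F L -> C q -> (forall w, C w -> 0 <= ip (F w) (w - q)) ->
  vi_solution ip C F q.
Proof.
move=> cC L0 F_lip Cq mq; split=> // w Cw; rewrite leNgt; apply/negP.
set a := ip (F q) (w - q) => a0.
have b0 : 0 <= ip (w - q) (w - q) by exact: ip_ge0.
set b := ip (w - q) (w - q) in b0.
have Lb0 : 0 <= L * b by rewrite mulr_ge0.
have den0 : 0 < L * b - a by lra.
(* At [t w + (1 - t) q], Lipschitz continuity bounds the pairing with [w - q] by [a + t L b], which
   for this [t] equals [t a < 0]. *)
pose t := - a / (L * b - a).
have t0 : 0 < t by rewrite divr_gt0 // oppr_gt0.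
have t1 : t <= 1 by rewrite ler_pdivrMr //; lra.
have tden : t * (L * b - a) = - a by rewrite mulfVK // gt_eqF.
have Cv : C (t *: w + (1 - t) *: q) by apply: cC => //; rewrite t1 ltW.
have vq : t *: w + (1 - t) *: q - q = t *: (w - q).
  by rewrite scalerBl scale1r scalerBr addrCA addrAC subrr add0r.
have := mq _ Cv; rewrite vq ipZr pmulr_rge0 // => mv.
have := F_lip (t *: w + (1 - t) *: q) q; rewrite vq hnormZ gtr0_norm // => lip.
have := ler_wpM2r (hnorm_ge0 (w - q)) lip.
rewrite -2!mulrA -expr2 sqr_hnorm -/b => lipb.
have := cauchy_schwarz (F (t *: w + (1 - t) *: q) - F q) (w - q).
by rewrite ipDl ipNl -/a; nra.
Qed.

End InnerProduct.

(** * Consequences of a single pass through Steps 2 to 4 *)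

Section AlgorithmStep.
Context {R : realType} {V : lmodType R} (ip : V -> V -> R).
Variables (C : V -> Prop) (F P : V -> V) (alpha lambar L : R).
Hypotheses (ipP : inner_product ip) (C_convex : convex_set C).
Hypotheses (L_gt0 : 0 < L) (F_lip : lipschitz_op ip F L).
Hypothesis P_proj : forall z, is_metric_proj ip C z (P z).
Hypotheses (alpha_gt0 : 0 < alpha) (lambar_gt0 : 0 < lambar).

Lemma min_ratio_le u v b : min_ratio ip F alpha u v b <= b.
Proof. by rewrite /min_ratio; case: eqP => // _; rewrite ge_min lexx orbT. Qed.

(** By Lipschitz continuity the quotient in the minimum is at least [alpha / L]. *)
Lemma min_ratio_ge u v b c : c <= alpha / L -> c <= b ->
  c <= min_ratio ip F alpha u v b.
Proof.
move=> cL cb; rewrite /min_ratio; case: eqP => // /eqP Fuv; rewrite le_min cb andbT.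
apply: le_trans cL _; have F0 : 0 < hnorm ip (F u - F v).
  by apply: (hnorm_gt0 ipP); rewrite subr_eq0.
rewrite ler_pdivlMr // mulrAC ler_pdivrMr // -mulrA ler_pM2l // mulrC.
exact: F_lip.
Qed.

Lemma proj_le0 z w : C w -> ip (z - P z) (w - P z) <= 0.
Proof. exact: metric_proj_le0. Qed.

Section Step.
Variables (x y : nat -> V) (lam theta : nat -> R) (n : nat).
Hypotheses (lam_gt0 : 0 < lam n) (theta_gt0 : 0 < theta n).
Hypotheses (Cx : C (x n)) (def_x : x n.+1 = P (x n - lam n *: F (y n))).
Hypothesis step : algA_step ip P F alpha lambar x y lam theta n.+1.
Let s2 := Num.sqrt (2%:R : R).
Let lf := lam_fun ip F alpha lambar (y n) (theta n) (lam n).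

Let lf_le v th : 0 < th -> lf v th <= lambar /\ th * lf v th <= (1 + theta n) * lam n.
Proof.
move=> th0; have := min_ratio_le v (y n)
  (Num.min ((1 + theta n) / th * lam n) lambar).
rewrite -/(lf v th) le_min => /andP[lf1 ->]; split=> //.
by rewrite mulrC -ler_pdivlMr // mulrAC.
Qed.

Let lf1_ge c : c <= alpha / L -> c <= lambar -> c <= lam n -> c <= lf (y n.+1) 1.
Proof.
move=> cL cl cn; apply: min_ratio_ge => //; rewrite le_min cl andbT divr1.
by apply: le_trans cn _; rewrite mulrDl mul1r lerDl mulr_ge0 ?ltW.
Qed.

Lemma algA_step_theta : 0 < theta n.+1 <= 1.
Proof.
by case: step => _ [|[]]; [move=> [_ [-> _]]|move=> [_ [_ [-> _]]]|case=> _ [_ []]];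
  rewrite ?ltr01 ?lexx.
Qed.

Lemma algA_step_y : y n.+1 = x n.+1 + theta n.+1 *: (x n.+1 - x n).
Proof.
case: step => _ [|[]]; last by case=> _ [_ [_ []]].
  by move=> [_ [-> [-> _]]]; rewrite scale1r scaler_nat mulr2n addrA.
by move=> [_ [_ [-> [-> _]]]]; rewrite scale1r scaler_nat mulr2n addrA.
Qed.

Lemma algA_step_x : x n.+2 = P (x n.+1 - lam n.+1 *: F (y n.+1)).
Proof.
case: step => _ [|[]].
- by move=> [_ [_ [-> [-> ->]]]].
- by move=> [_ [_ [_ [-> [_ [_ ->]]]]]].
- by move=> [_ [_ [_ [_ [_ [_ [_ ->]]]]]]].
Qed.

Lemma algA_step_lam_le :
  lam n.+1 <= lambar /\ theta n.+1 * lam n.+1 <= (1 + theta n) * lam n.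
Proof.
have [t0 _] := andP algA_step_theta.
suff lamlf : lam n.+1 <= lf (y n.+1) (theta n.+1).
  have [lf1 lf2] := lf_le (y n.+1) t0; split; first exact: le_trans lf1.
  by apply: le_trans lf2; rewrite ler_pM2l.
case: step => _ [|[]].
- by move=> [_ [-> [-> [-> _]]]].
- by move=> [_ [_ [-> [-> [/andP[_ +] _]]]]].
- by move=> [_ [_ [_ [_ [_ [/andP[_ +] _]]]]]].
Qed.

(** For such [lam n] the trial step size is at least [lam n], since [(1 + theta n) lam n >= lam n];
    this excludes case (ii) of Step 4. *)
Lemma algA_step_lam_ge : lam n < Num.min (alpha / L) lambar ->
  theta n.+1 = 1 /\ lam n <= lam n.+1.
Proof.
rewrite lt_min => /andP[/ltW lamL /ltW lambar1].
case: step => _ [|[]].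
- move=> [_ [-> [yn [-> _]]]]; split=> //.
  by rewrite /= -yn; apply: lf1_ge.
- by move=> [_ [_ [-> [_ [/andP[] ]]]]].
- move=> [_ [+ _]]; rewrite ltNge => /negP[].
  apply: min_ratio_ge => //=; rewrite le_min lambar1 andbT divr1.
  by rewrite mulrDl mul1r lerDl mulr_ge0 ?ltW.
Qed.

Lemma algA_step_lam_gt0 : 0 < lam n.+1.
Proof.
case: step => _ [|[]].
- move=> [_ [_ [yn [-> _]]]]; rewrite /= -yn.
  have c0 : 0 < Num.min (alpha / L) (Num.min lambar (lam n)).
    by rewrite !lt_min divr_gt0 // lambar_gt0.
  by apply: lt_le_trans c0 _; apply: lf1_ge; rewrite !ge_min lexx ?orbT.
- by move=> [_ [_ [_ [_ [/andP[+ _] _]]]]]; exact: lt_le_trans.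
- move=> [_ [_ [/andP[t0 _] [_ [_ [/andP[+ _] _]]]]]].
  by apply: lt_le_trans; rewrite mulr_gt0.
Qed.

Lemma algA_step_descent :
  - ip (x n.+2 - x n.+1) (x n.+2 - x n.+1) +
    2 * lam n.+1 * ip (F (y n.+1)) (y n.+1 - x n.+2) +
    (1 - alpha * (1 + s2)) * ip (x n.+1 - y n.+1) (x n.+1 - y n.+1) -
    alpha * ip (x n.+1 - y n) (x n.+1 - y n) +
    (1 - s2 * alpha) * ip (x n.+2 - y n.+1) (x n.+2 - y n.+1) <= 0.
Proof.
have s0 : 0 <= s2 by exact: sqrtr_ge0.
have ss : s2 ^+ 2 = 2 by rewrite sqr_sqrtr.
have a0 := ltW alpha_gt0; have [/ltW t0 _] := andP algA_step_theta.
have p0 := proj_le0 (x n - lam n *: F (y n)) Cx; rewrite -def_x in p0.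
have Cx2 : C (x n.+2).
  by rewrite algA_step_x; case: (P_proj (x n.+1 - lam n.+1 *: F (y n.+1))).
have p2 := proj_le0 (x n - lam n *: F (y n)) Cx2; rewrite -def_x in p2.
have main := extrapolation_descent ipP s0 ss a0 t0 algA_step_y p0 p2.
case: step => _ [|[]].
- move=> [+ [_ [yn [+ +]]]]; rewrite /= -yn => + lamn; rewrite -lamn => + xn.
  by rewrite -xn !(sqr_hnorm ipP).
- move=> [_ [_ [tn [yn [_ [gap _]]]]]]; apply: main.
  by rewrite tn mul1r yn.
- by move=> [_ [_ [_ [_ [_ [_ [gap _]]]]]]]; exact: main.
Qed.

End Step.
End AlgorithmStep.

(** * Asymptotics of an infinite run *)

Section Run.
Context {R : realType} {V : lmodType R} (ip : V -> V -> R).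
Variables (C : V -> Prop) (F P : V -> V) (alpha lam_m1 lambar L : R).
Variables (x y : nat -> V) (lam theta : nat -> R).
Hypotheses (hilbert : real_hilbert_space ip).
Hypotheses (C_closed : closed_set ip C) (C_convex : convex_set C).
Hypotheses (F_mono : monotone_op ip F) (L_gt0 : 0 < L) (F_lip : lipschitz_op ip F L).
Hypothesis P_proj : forall z, is_metric_proj ip C z (P z).
Hypotheses (alpha_bounds : 0 < alpha < Num.sqrt (2%:R : R) - 1) (lambar_gt0 : 0 < lambar).
Hypotheses (Cx0 : C (x 0%N)) (run : algA_run ip P F alpha lambar lam_m1 x y lam theta).

Let ipP : inner_product ip := hilbert.1.
Let complV : complete_space ip := hilbert.2.
Let alpha_gt0 : 0 < alpha. Proof. by have [] := andP alpha_bounds. Qed.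
Let s2 := Num.sqrt (2%:R : R).
Let kappa := 1 - alpha * (1 + s2).

Let s2_ge0 : 0 <= s2. Proof. exact: sqrtr_ge0. Qed.

(** This is where [alpha < sqrt 2 - 1] enters: [(sqrt 2 - 1) (sqrt 2 + 1) = 1]. *)
Let kappa_gt0 : 0 < kappa.
Proof.
have [_] := andP alpha_bounds; rewrite -/s2 => al.
have ss : s2 ^+ 2 = 2 by rewrite sqr_sqrtr.
by rewrite /kappa; have := s2_ge0; nra.
Qed.

Let run_inv n :
  [/\ C (x n), 0 < lam n, 0 < theta n & x n.+1 = P (x n - lam n *: F (y n))].
Proof.
have [[th0 [_ [lam0 x1]]] steps] := run.
elim: n => [|n [Cxn lamn thn xn]].
  split=> //; last by rewrite th0.
  have c0 : 0 < Num.min (alpha / L) lambar by rewrite lt_min divr_gt0.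
  rewrite lam0; apply: lt_le_trans c0 _.
  by apply: (min_ratio_ge ipP L_gt0 F_lip alpha_gt0); rewrite ge_min lexx ?orbT.
have stepn := steps n.+1 isT; split.
- by rewrite xn; case: (P_proj (x n - lam n *: F (y n))).
- exact: (algA_step_lam_gt0 ipP L_gt0 F_lip alpha_gt0 lambar_gt0 lamn thn stepn).
- by have /andP[] := algA_step_theta stepn.
- exact: algA_step_x stepn.
Qed.

Let Cx n : C (x n). Proof. by have [] := run_inv n. Qed.
Let lam_gt0 n : 0 < lam n. Proof. by have [] := run_inv n. Qed.
Let theta_gt0 n : 0 < theta n. Proof. by have [] := run_inv n. Qed.
Let xE n : x n.+1 = P (x n - lam n *: F (y n)). Proof. by have [] := run_inv n. Qed.
Let stepS n : algA_step ip P F alpha lambar x y lam theta n.+1.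
Proof. by have [_] := run; apply. Qed.

Let proj_x n w : C w -> ip (x n - lam n *: F (y n) - x n.+1) (w - x n.+1) <= 0.
Proof. by rewrite xE => Cw; apply: (proj_le0 ipP C_convex P_proj). Qed.

Let theta_le1 n : theta n <= 1.
Proof.
case: n => [|n]; first by have [[-> _] _] := run.
by have /andP[] := algA_step_theta (stepS n).
Qed.

Let lam_le n : lam n <= lambar.
Proof.
case: n => [|n]; first by have [[_ [_ [-> _]]] _] := run; exact: min_ratio_le.
by have [] := algA_step_lam_le (stepS n).
Qed.

Let sol_ge0 z n : vi_solution ip C F z -> 0 <= ip (F z) (x n - z).
Proof. by case=> _; apply. Qed.

Let lyap z n : R := ip (x n.+1 - z) (x n.+1 - z) +
  alpha * ip (x n.+1 - y n) (x n.+1 - y n) +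
  2 * ((1 + theta n) * lam n * ip (F z) (x n - z)).

Let lyap_decr z n : vi_solution ip C F z ->
  kappa * (ip (x n.+1 - y n.+1) (x n.+1 - y n.+1) +
           ip (x n.+2 - y n.+1) (x n.+2 - y n.+1)) <= lyap z n - lyap z n.+1.
Proof.
move=> Sz; rewrite lerBrDl.
have [_ thl] := algA_step_lam_le (stepS n).
apply: (lyapunov_step ipP s2_ge0 (ltW alpha_gt0) (ltW (lam_gt0 _)) thl
  (algA_step_y (stepS n)) (sol_ge0 n Sz) (F_mono _ _)).
  by apply: proj_x; case: Sz.
exact: (algA_step_descent ipP C_convex P_proj alpha_gt0 (Cx n) (xE n) (stepS n)).
Qed.

Let lyap_ge z n : vi_solution ip C F z -> ip (x n.+1 - z) (x n.+1 - z) <= lyap z n.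
Proof.
move=> Sz; rewrite /lyap -addrA lerDl addr_ge0 ?mulr_ge0 ?(ltW alpha_gt0) //.
- exact: ip_ge0.
- by rewrite addr_ge0 // ltW.
- exact: ltW.
- exact: sol_ge0.
Qed.

Let lyap_homo z : vi_solution ip C F z -> {homo lyap z : m n / (m <= n)%N >-> n <= m}.
Proof.
move=> Sz; apply/nonincreasing_seqP => n.
rewrite -subr_ge0; apply: le_trans (lyap_decr n Sz).
by rewrite mulr_ge0 ?(ltW kappa_gt0) // addr_ge0 ?ip_ge0.
Qed.

Let lyap_cvg z : vi_solution ip C F z -> cvgn (lyap z).
Proof.
move=> Sz; apply: nonincreasing_is_cvgn; first exact: lyap_homo.
by exists 0 => _ [n _ <-]; apply: le_trans (ip_ge0 ipP _) (lyap_ge n Sz).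
Qed.

Hypothesis solvable : exists z, vi_solution ip C F z.

Let xy_cvg : (fun n => hnorm ip (x n - y n)) @ \oo --> (0 : R).
Proof.
have [z Sz] := solvable; rewrite -cvg_shiftS.
apply: (telescope_cvg0 ipP kappa_gt0 (lyap_cvg Sz)) => n.
apply: le_trans (lyap_decr n Sz); rewrite ler_pM2l // lerDl; exact: ip_ge0.
Qed.

Let x1y_cvg : (fun n => hnorm ip (x n.+1 - y n)) @ \oo --> (0 : R).
Proof.
have [z Sz] := solvable; rewrite -cvg_shiftS.
apply: (telescope_cvg0 ipP kappa_gt0 (lyap_cvg Sz)) => n.
apply: le_trans (lyap_decr n Sz); rewrite ler_pM2l // lerDr; exact: ip_ge0.
Qed.

(* [p n - e n] lies in [F (x n.+1) + N_C (x n.+1)] *)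
Let p n := (lam n)^-1 *: (x n - x n.+1).
Let e n := F (y n) - F (x n.+1).

Let lam_p n : lam n *: p n = x n - x n.+1.
Proof. by rewrite scalerA divff ?scale1r // gt_eqF. Qed.

Let lam_p_cvg : (fun n => hnorm ip (lam n *: p n)) @ \oo --> (0 : R).
Proof.
have sum0 : (fun n => hnorm ip (x n - y n) + hnorm ip (x n.+1 - y n)) @ \oo --> (0 : R).
  by rewrite -[0]addr0; exact: cvgD xy_cvg x1y_cvg.
apply: squeeze_cvgr (cvg_cst 0) sum0; near=> n.
rewrite hnorm_ge0 lam_p (hnormB ipP (x n.+1)) /=.
by rewrite -[x n in leLHS](subrK (y n)) -addrA; exact: hnormD.
Unshelve. all: by end_near.
Qed.

Let e_le n : hnorm ip (e n) <= L * hnorm ip (x n.+1 - y n).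
Proof. by rewrite (hnormB ipP (x n.+1)); exact: F_lip. Qed.

Let e_cvg : (fun n => hnorm ip (e n)) @ \oo --> (0 : R).
Proof.
have L0 : (fun n => L * hnorm ip (x n.+1 - y n)) @ \oo --> (0 : R).
  by rewrite -(mulr0 L); exact: cvgM (cvg_cst L) x1y_cvg.
by apply: squeeze_cvgr (cvg_cst 0) L0; near=> n; rewrite hnorm_ge0 e_le.
Unshelve. all: by end_near.
Qed.

Let p_cvg : (fun n => hnorm ip (p n)) @ \oo --> (0 : R).
Proof.
(* Below the first two bounds [theta n.+1 = 1] and [lam] does not decrease; the third gives
   [L delta <= 1/8]. *)
pose delta := Num.min (Num.min (alpha / L) lambar) (8^-1 / L).
have delta0 : 0 < delta by rewrite !lt_min lambar_gt0 !divr_gt0 ?invr_gt0.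
apply: (residual_cvg0 ipP (ltW L_gt0) delta0 _ lam_gt0 _ _ e_cvg lam_p_cvg).
- by rewrite mulrC -ler_pdivlMr // ge_min lexx orbT.
- move=> n; apply: (residual_mono ipP) => //; exact: proj_x.
- move=> n; rewrite lt_min => /andP[lamn _].
  have [th1 ll] := algA_step_lam_ge ipP L_gt0 F_lip alpha_gt0
    (lam_gt0 n) (theta_gt0 n) (stepS n) lamn.
  split=> //; rewrite !lam_p; apply: le_trans (e_le _) _.
  (* For [theta n.+1 = 1], [y n.+1 - x n.+2 = (x n.+1 - x n.+2) - (x n - x n.+1)]. *)
  rewrite (hnormB ipP (x n.+2)) (algA_step_y (stepS n)) th1 scale1r.
  by rewrite opprB [x n.+1 + _ - _]addrAC.
Qed.

Let residual_variational n w : C w ->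
  ip (F (x n.+1)) (x n.+1 - w) <= ip (p n - e n) (x n.+1 - w).
Proof.
move=> /proj_x - /(_ n); rewrite addrAC -lam_p -scalerBr (ipZl ipP) pmulr_rle0 //.
by rewrite -(opprB (x n.+1)) /e !(ipE ipP); lra.
Qed.

Let x_bounded : exists M, forall n, hnorm ip (x n) <= M.
Proof.
have [z Sz] := solvable.
exists (hnorm ip (x 0%N) + (Num.sqrt (lyap z 0) + hnorm ip z)) => -[|n].
  by rewrite lerDl addr_ge0 ?hnorm_ge0 ?sqrtr_ge0.
rewrite -[x n.+1](subrK z); apply: le_trans (hnormD ipP _ _) _.
apply: ler_wpDl; first exact: hnorm_ge0.
rewrite lerD2r ler_wsqrtr //; apply: le_trans (lyap_ge n Sz) _.
exact: lyap_homo.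
Qed.

(** Monotonicity replaces [F w] by [F (x n.+1)], then [residual_variational] applies; [x] is bounded
    and [p], [e] tend to 0. *)
Let bound w : exists2 r : nat -> R, r @ \oo --> (0 : R) &
  C w -> forall n, ip (F w) (x n - w) <= r n.
Proof.
have [M xM] := x_bounded.
pose r n := (hnorm ip (p n) + hnorm ip (e n)) * (M + hnorm ip w).
have pe_cvg : (fun n => hnorm ip (p n) + hnorm ip (e n)) @ \oo --> (0 : R).
  by rewrite -[0]addr0; exact: cvgD p_cvg e_cvg.
(* The residual estimate starts at [x 1]; index 0 takes its own value. *)
exists (fun n => if n is m.+1 then r m else ip (F w) (x 0%N - w)).
  have r_cvg : r @ \oo --> (0 : R).
    rewrite -(mul0r (M + hnorm ip w)).
    exact: (cvgM pe_cvg (cvg_cst (M + hnorm ip w))).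
  by rewrite -cvg_shiftS.
move=> Cw [//|n].
have := F_mono (x n.+1) w; rewrite (ipDl ipP) (ipNl ipP) subr_ge0 => mono.
apply: le_trans mono _; apply: le_trans (residual_variational n Cw) _.
apply: le_trans (cauchy_schwarz ipP _ _) _.
apply: ler_pM; rewrite ?hnorm_ge0 //.
  by rewrite -(hnormN ipP (e n)); exact: hnormD.
apply: le_trans (hnormD ipP _ _) _; rewrite hnormN //; exact: lerD.
Qed.

(** [lyap z] converges and its last two terms vanish: the dual one lies between 0 and
    [4 lambar r n]. *)
Let dist_cvg z : vi_solution ip C F z -> cvgn (fun n => ip (x n - z) (x n - z)).
Proof.
move=> Sz; have [r r0 xr] := bound z; have [Cz _] := Sz.
have cvg_alpha : (fun n => alpha * hnorm ip (x n.+1 - y n) ^+ 2) @ \oo --> (0 : R).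
  rewrite -(mulr0 alpha) -(mulr0 0); apply: cvgM (cvg_cst alpha) _.
  exact: cvgM x1y_cvg x1y_cvg.
have cvg_dual : (fun n => 2 * ((1 + theta n) * lam n * ip (F z) (x n - z))) @ \oo -->
    (0 : R).
  have cvg_bound : (fun n => 4 * lambar * r n) @ \oo --> (0 : R).
    by rewrite -(mulr0 (4 * lambar)); exact: cvgM (cvg_cst _) r0.
  apply: squeeze_cvgr (cvg_cst 0) cvg_bound; near=> n; apply/andP; split.
    by rewrite !mulr_ge0 ?addr_ge0 ?sol_ge0 // ltW.
  have -> : 4 * lambar * r n = 2 * ((2 * lambar) * r n) by ring.
  rewrite ler_pM2l //; apply: ler_pM; rewrite ?xr ?sol_ge0 //.
    by rewrite mulr_ge0 ?addr_ge0 // ltW.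
  apply: ler_pM; rewrite ?lam_le ?addr_ge0 ?(ltW (lam_gt0 _)) ?(ltW (theta_gt0 _)) //.
  by have := theta_le1 n; lra.
have /cvg_ex[l lyapl] := lyap_cvg Sz.
apply/(cvgP l); rewrite -cvg_shiftS.
have -> : [sequence ip (x n.+1 - z) (x n.+1 - z)]_n = (fun n => lyap z n -
    alpha * hnorm ip (x n.+1 - y n) ^+ 2 -
    2 * ((1 + theta n) * lam n * ip (F z) (x n - z))).
  by apply/funext => n; rewrite /lyap (sqr_hnorm ipP) /=; ring.
rewrite -[l]subr0 -[l - 0]subr0; exact: cvgB (cvgB lyapl cvg_alpha) cvg_dual.
Unshelve. all: by end_near.
Qed.

(** [bound] passes to the cluster point as [<F w, q - w> <= 0], the hypothesis of [minty]. *)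
Let cluster_solution (f : nat -> nat) q : (forall n, (n <= f n)%N) ->
  weak_cluster ip (x \o f) q -> vi_solution ip C F q.
Proof.
move=> f_ge xq; have Cq : C q by apply: xq => //; near=> n; exact: Cx.
apply: (minty ipP C_convex (ltW L_gt0) F_lip Cq) => w Cw.
rewrite (ipDr ipP) (ipNr ipP) subr_ge0 (ipC ipP _ q).
apply/ler_addgt0Pr => eps eps0; apply: (weak_cluster_le ipP xq).
have [r r0 xr] := bound w; have [N _ rN] := cvgr_le _ r0 _ eps0.
exists N => // n /= Nn; have := xr Cw (f n); have := rN (f n) (leq_trans Nn (f_ge n)).
by rewrite /= (ipDr ipP) (ipNr ipP) (ipC ipP (x _)); lra.
Unshelve. all: by end_near.
Qed.

(** Opial's lemma gives the limit of [x]; [y] shares it because [x n - y n] tends to 0 in norm. *)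
Lemma algA_run_weak_cvg :
  exists xs, vi_solution ip C F xs /\ weak_cvg ip x xs /\ weak_cvg ip y xs.
Proof.
have [M xM] := x_bounded.
have [q Sq xq] := opial ipP complV xM dist_cvg cluster_solution.
exists q; split=> //; split=> // v eps eps0.
have eps2 : 0 < eps / 2 by rewrite divr_gt0.
have v1 : 0 < hnorm ip v + 1 by rewrite ltr_wpDl ?hnorm_ge0.
have [N1 xN1] := xq v _ eps2.
have [N2 _ xyN2] := cvgr_lt _ xy_cvg _ (divr_gt0 eps2 v1).
exists (maxn N1 N2) => n; rewrite geq_max => /andP[N1n N2n].
have -> : ip (y n) v - ip q v = (ip (x n) v - ip q v) - ip (x n - y n) v.
  by rewrite !(ipE ipP); ring.
apply: le_lt_trans (ler_normB _ _) _.
have := xN1 n N1n; have := normr_ip ipP (x n - y n) v.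
have := xyN2 n N2n; rewrite /= ltr_pdivlMr //.
by have := hnorm_ge0 ip (x n - y n); lra.
Qed.

End Run.

Theorem theorem4p6 (R : realType) (V : lmodType R) (ip : V -> V -> R)
  (C : V -> Prop) (F : V -> V) (L : R) (P : V -> V)
  (alpha lam_m1 lambar : R)
  (x y : nat -> V) (lam theta : nat -> R) :
  real_hilbert_space ip ->
  (exists c, C c) -> closed_set ip C -> convex_set C ->
  monotone_op ip F -> 0 < L -> lipschitz_op ip F L ->
  (exists xs, vi_solution ip C F xs) ->
  (forall z, is_metric_proj ip C z (P z)) ->
  0 < lam_m1 -> 0 < alpha < Num.sqrt (2%:R : R) - 1 -> 0 < lambar ->
  C (x 0%N) ->
  algA_run ip P F alpha lambar lam_m1 x y lam theta ->
  exists xs : V, vi_solution ip C F xs /\ weak_cvg ip x xs /\ weak_cvg ip y xs.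
Proof.
move=> hilbert _ Ccl Ccv Fm L0 Fl sol proj _ al lb Cx0 run.
exact: (algA_run_weak_cvg hilbert Ccl Ccv Fm L0 Fl proj al lb Cx0 run sol).
Qed.
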